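(* Let $u\in\mathbb{F}_q[t]$ be a nonzero square-free polynomial, and let $g,h\in\mathbb{F}_q[t]$ with $g\neq 0$ and $\gcd(g,h)=1$. Then there are infinitely many square-free monic polynomials $w\in\mathbb{F}_q[t]$, all of whose irreducible monic factors are congruent to $h$ modulo $g$, such that $uw$ is a Carmichael polynomial.
   Context: $\mathbb{F}_q$ is the finite field with $q$ elements. A finite ring $S$ is a Carmichael ring if $S$ is not a field and $a^{|S|}=a$ for every $a\in S$. A polynomial $f\in\mathbb{F}_q[t]$ is a Carmichael polynomial if $\mathbb{F}_q[t]/(f)$ is a Carmichael ring (equivalently, for composite $f$: $f$ is square-free and $\deg P\mid \deg f$ for every irreducible factor $P$ of $f$). *)

(* Defs.v *)
From HB Require Import structures.
From mathcomp Require Import all_boot all_order all_algebra all_field.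
Set Implicit Arguments. Unset Strict Implicit. Unset Printing Implicit Defensive.
Import GRing.Theory.
Local Open Scope ring_scope.

(* f is square-free: no square of a non-constant polynomial divides f.
   (In particular f <> 0, since every polynomial divides 0.) *)
Definition squarefree_poly (F : fieldType) (f : {poly F}) : Prop :=
  forall d : {poly F}, (1 < size d)%N -> ~~ (d * d %| f).

Definition quot_is_field (F : fieldType) (f : {poly F}) : Prop :=
  ~~ (f %| 1) /\
  forall a : {poly F}, ~~ (f %| a) -> exists b : {poly F}, f %| (a * b - 1).

(* f is a Carmichael polynomial: S = F_q[t]/(f) is a finite ring (f <> 0,
   |S| = q^(deg f)), S is not a field, and a^|S| = a for all a in S. *)
Definition carmichael_poly (F : finFieldType) (f : {poly F}) : Prop :=
  f != 0 /\ ~ quot_is_field f /\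
  forall a : {poly F}, f %| (a ^+ (#|F| ^ (size f).-1) - a).

(* Main.v *)
(** For a completely multiplicative [phi : F_q[t] -> C] let [L(z)] be the sum of
    [phi(f) z^(deg f)] over monic [f]. Modulo [z^N] it is the inverse of the
    Euler product over irreducibles of degree less than [N], so everything
    happens with polynomials over the algebraic numbers and no convergence is
    needed. For a nontrivial Dirichlet character modulo [g], [L] is a polynomial.

    If [L(x/q) = 0] with [|x| <= 1], then
    [(1 - q z^2) |L(xz)|^2 / (1 - qz)^2] (for real [z]) is a polynomial; its Euler
    factors have nonnegative coefficients and its constant term is 1, which
    contradicts its vanishing at [z = q^(-1/2)]. Hence all reciprocal roots of
    [L] have modulus less than [q], and comparing logarithmic derivatives and
    using orthogonality of characters, the number of monic irreducibles
    [P = h mod g] of degree [n] eventually exceeds any multiple of [n].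

    Let [m = deg u], [k = m!] and [a] large. With [w] the product of [m] such
    irreducibles of degree [a] and [a k - m] of degree [a + 1], the degree of
    [u w] is [a (a + 1) k], a multiple of the degrees of all its irreducible
    factors. *)

Require Import Defs.
From HB Require Import structures.
From mathcomp Require Import all_boot all_order all_fingroup all_algebra.
From mathcomp Require Import all_field all_character.
From mathcomp Require Import ring zify.
Set Implicit Arguments. Unset Strict Implicit. Unset Printing Implicit Defensive.
Import Order.TTheory GRing.Theory Num.Theory.
Local Open Scope ring_scope.

(** * Power series truncated at order N, as congruences between polynomials *)

Definition eqmodX (C : fieldType) N (a b : {poly C}) := 'X^N %| a - b.
Notation "a =[ N ] b" := (eqmodX N a b)
  (at level 70, N at level 50, format "a  =[ N ]  b") : ring_scope.

Section ModX.
Variable C : fieldType.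
Implicit Types (a b c d : {poly C}) (N : nat).

Lemma eqmodXP N a b : reflect (forall i, (i < N)%N -> a`_i = b`_i) (a =[N] b).
Proof.
apply: (iffP idP) => [/dvdpP[r rE] i iN | ab].
  by apply/eqP; rewrite -subr_eq0 -coefB rE coefMXn iN.
apply/dvdpP; exists (drop_poly N (a - b)).
rewrite -[LHS](poly_take_drop N) [take_poly N _](_ : _ = 0) ?add0r //.
apply/polyP=> i; rewrite coef_take_poly coef0; case: ltnP => // iN.
by rewrite coefB ab // subrr.
Qed.

Lemma eqmodX_refl N a : a =[N] a.
Proof. exact/eqmodXP. Qed.

Lemma eqmodX_sym N a b : a =[N] b -> b =[N] a.
Proof. by rewrite /eqmodX -opprB dvdpNr. Qed.

Lemma eqmodX_trans N b a c : a =[N] b -> b =[N] c -> a =[N] c.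
Proof. by move=> ab bc; rewrite /eqmodX -(subrK b a) -addrA dvdp_add. Qed.

Lemma eqmodXM N a b c d : a =[N] b -> c =[N] d -> a * c =[N] b * d.
Proof.
move=> ab cd; rewrite /eqmodX (_ : _ - _ = (a - b) * c + b * (c - d)); last ring.
by apply: dvdp_add; [apply: dvdp_mulr | apply: dvdp_mull].
Qed.

Lemma eqmodXMl N c a b : a =[N] b -> c * a =[N] c * b.
Proof. by move=> ab; apply/eqmodXM=> //; apply: eqmodX_refl. Qed.

Lemma eqmodXMr N c a b : a =[N] b -> a * c =[N] b * c.
Proof. by move=> ab; apply/eqmodXM=> //; apply: eqmodX_refl. Qed.

Lemma eqmodX_prod N (I : eqType) (r : seq I) (A B : I -> {poly C}) :
  (forall i, i \in r -> A i =[N] B i) ->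
  \prod_(i <- r) A i =[N] \prod_(i <- r) B i.
Proof.
move=> AB; rewrite big_seq [X in _ =[_] X]big_seq.
by elim/big_rec2: _ => [|i a b ir]; [exact: eqmodX_refl | apply/eqmodXM/AB].
Qed.

(** A factor with nonzero constant term is coprime to ['X^N], that is, invertible as a power
    series. *)
Lemma eqmodX_cancel N c a b : c`_0 != 0 -> c * a =[N] c * b -> a =[N] b.
Proof.
move=> c0; rewrite /eqmodX -mulrBr Gauss_dvdpr // coprimep_expl //.
by rewrite coprimep_sym coprimepX -horner_coef0 in c0 *.
Qed.

Lemma eqmodX_comp N k a b : (0 < k)%N -> a =[N] b -> a \Po 'X^k =[N] b \Po 'X^k.
Proof.
move=> k0; rewrite /eqmodX -comp_polyB => /dvdpP[r ->].
rewrite comp_polyM comp_Xn_poly -exprM dvdp_mull //.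
by rewrite dvdp_exp2l // leq_pmull.
Qed.

End ModX.

(** * Logarithmic derivatives of Euler products and power sums *)

Section Newton.
Variable C : fieldType.
Implicit Types (l : seq (nat * C)) (N n : nat).

(** A pair [(k, a)] encodes an Euler factor at a prime of degree k or, when k = 1, a reciprocal root
    a. *)
Definition euler_prod l : {poly C} := \prod_(x <- l) (1 - x.2 *: 'X^(x.1)).

(** For n > 0 this is the coefficient of X^n in -X A'/A with [A = euler_prod l]; it is the usual
    power sum when all exponents are 1. *)
Definition power_sum l n : C :=
  \sum_(x <- l | (x.1 %| n)%N) x.1%:R * x.2 ^+ (n %/ x.1).

(** For B = 1 - a X^k, the series -X B'/B is k a X^k / (1 - a X^k), the sum of k a^j X^(k j) over j
    >= 1; here the denominator is cleared. *)
Lemma log_deriv_factor N k (a : C) : (0 < k)%N ->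
  - ('X * (1 - a *: 'X^k)^`()) =[N]
  (1 - a *: 'X^k) * \poly_(n < N)
     (if n == 0%N then 0 else if (k %| n)%N then k%:R * a ^+ (n %/ k) else 0).
Proof.
move=> k0; apply/eqmodXP => i iN.
rewrite derivB derivC derivZ derivXn sub0r.
rewrite mulrBl mul1r -scalerAl coefN coefXM coefB coefZ coefXnM !coef_poly iN.
rewrite coefN coefZ coefMn coefXn /=.
have [->|i0] := eqVneq i 0%N; first by rewrite k0 mulr0 subrr oppr0.
have [ik|ki] := ltnP i k.
  rewrite gtnNdvd ?lt0n // mulr0 subr0.
  by rewrite (_ : (i.-1 == k.-1) = false) ?mulr0n ?mul0rn ?mulr0 ?oppr0 ?opprK //; lia.
rewrite (leq_ltn_trans (leq_subr _ _) iN).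
have -> : (k %| i - k)%N = (k %| i)%N :> bool by rewrite dvdn_subl.
have [<-|ik] := eqVneq k i.
  rewrite !eqxx subnn eqxx /= dvdnn divnn k0 expr1 mulr0 subr0.
  by rewrite opprK mulrC.
have -> : (i.-1 == k.-1) = false by lia.
have -> : (i - k == 0)%N = false by lia.
rewrite mul0rn mulr0 !oppr0; case: ifP => [/dvdnP[j ij]|_]; last by rewrite mulr0 subr0.
have j1 : (1 < j)%N by nia.
rewrite ij (_ : j * k - k = j.-1 * k)%N; last by nia.
rewrite !mulnK // mulrCA -exprS prednK ?subrr //; exact: ltnW.
Qed.

Lemma log_deriv_euler_prod N l : all (fun x => 0 < x.1)%N l ->
  - ('X * (euler_prod l)^`()) =[N]
  euler_prod l * \poly_(n < N) (if n == 0%N then 0 else power_sum l n).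
Proof.
rewrite /euler_prod; elim: l => [_|[k a] l IH /= /andP[k0 /IH{}IH]].
  rewrite big_nil derivC mulr0 oppr0 mul1r; apply/eqmodXP => i iN.
  by rewrite coef0 coef_poly iN /power_sum big_nil if_same.
rewrite big_cons /= in IH *; set A := \prod_(x <- l) _ in IH *; set B := 1 - _.
rewrite derivM mulrDr opprD mulrA -mulNr.
have -> : \poly_(n < N) (if n == 0%N then 0 else power_sum ((k, a) :: l) n) =
   \poly_(n < N) (if n == 0%N then 0 else
      if (k %| n)%N then k%:R * a ^+ (n %/ k) else 0)
   + \poly_(n < N) (if n == 0%N then 0 else power_sum l n).
  apply/polyP=> i; rewrite coefD !coef_poly; case: ifP => // _; last by rewrite add0r.
  case: ifP; rewrite ?add0r // => _; rewrite /power_sum big_cons /=.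
  by case: ifP; rewrite ?add0r.
set T := \poly_(n < N) _; set U := \poly_(n < N) _.
rewrite /eqmodX (_ : _ - _ =
  (- ('X * B^`()) - B * T) * A + B * (- ('X * A^`()) - A * U));
  last ring.
by apply: dvdp_add; [apply/dvdp_mulr/log_deriv_factor | apply: dvdp_mull].
Qed.

Lemma euler_prod_coef0 l : all (fun x => 0 < x.1)%N l -> (euler_prod l)`_0 = 1.
Proof.
rewrite /euler_prod; elim: l => [_|x l IH /= /andP[x0 /IH{}IH]].
  by rewrite big_nil coef1.
rewrite big_cons coef0M IH coefB coefZ coefXn coef1 mulr1.
by rewrite (ltn_eqF x0) mulr0 subr0.
Qed.

Lemma eq_power_sum N n l l' :
  all (fun x => 0 < x.1)%N l -> all (fun x => 0 < x.1)%N l' ->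
  euler_prod l =[N] euler_prod l' -> (0 < n < N)%N -> power_sum l n = power_sum l' n.
Proof.
move=> l0 l'0 ll' /andP[n0 nN].
(* Differentiation loses one order of precision and the factor X restores it. *)
have A0 : - ('X * (euler_prod l)^`()) =[N] - ('X * (euler_prod l')^`()).
  apply/eqmodXP => -[|i] iN; rewrite !coefN !coefXM //=.
  by rewrite !coef_deriv (eqmodXP _ _ _ ll').
have := eqmodX_trans (eqmodX_trans (eqmodX_sym (log_deriv_euler_prod N l0)) A0)
  (log_deriv_euler_prod N l'0).
move/eqmodX_trans/(_ (eqmodXMr _ (eqmodX_sym ll')))/eqmodX_cancel.
rewrite euler_prod_coef0 // oner_neq0 => /(_ isT)/eqmodXP/(_ n nN).
by rewrite !coef_poly nN -[n == 0%N]negbK -lt0n n0.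
Qed.

End Newton.

(** * Nonnegativity of the local Euler factors *)

Section LocalFactor.

Definition nneg_coefs (p : {poly algC}) := forall i, 0 <= p`_i.

Lemma nneg_coefsD p q : nneg_coefs p -> nneg_coefs q -> nneg_coefs (p + q).
Proof. by move=> p0 q0 i; rewrite coefD addr_ge0. Qed.

Lemma nneg_coefsM p q : nneg_coefs p -> nneg_coefs q -> nneg_coefs (p * q).
Proof. by move=> p0 q0 i; rewrite coefM sumr_ge0 // => j _; rewrite mulr_ge0. Qed.

Lemma nneg_coefs1 : nneg_coefs 1.
Proof. by move=> i; rewrite coef1 ler0n. Qed.

Lemma nneg_coefs_prod (I : eqType) (r : seq I) (K : I -> {poly algC}) :
  (forall i, i \in r -> nneg_coefs (K i)) -> nneg_coefs (\prod_(i <- r) K i).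
Proof.
move=> K0; rewrite big_seq; apply: big_ind => //.
- exact: nneg_coefs1.
- exact: nneg_coefsM.
Qed.

Lemma nneg_coefs_comp_Xn k p : (0 < k)%N -> nneg_coefs p -> nneg_coefs (p \Po 'X^k).
Proof.
by move=> k0 p0 i; rewrite coef_comp_poly_Xn //; case: ifP.
Qed.

Lemma nneg_coefs_horner p x : nneg_coefs p -> 0 <= x -> p`_0 <= p.[x].
Proof.
move=> p0 x0; rewrite (horner_coef_wide x (leqnSn (size p))) big_ord_recl.
by rewrite expr0 mulr1 lerDl sumr_ge0 // => i _; rewrite mulr_ge0 ?exprn_ge0.
Qed.

(** The recurrences give s k = 1 + c + .. + c^k. The four linear factors amount to a recurrence of
    order 4, so coefficients 0 to 3 are checked singly and all later ones uniformly. *)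
Lemma geom_conv_factor (C : fieldType) N (c c' : C) (s s' : nat -> C) :
  s 0%N = 1 -> s' 0%N = 1 ->
  (forall k, s k.+1 = 1 + c * s k) -> (forall k, s' k.+1 = 1 + c' * s' k) ->
  (1 - 'X) * (1 - c *: 'X) * (1 - c' *: 'X) * (1 - (c * c') *: 'X) *
    \poly_(k < N) (s k * s' k) =[N] 1 - (c * c') *: 'X^2.
Proof.
move=> s0 s'0 sS s'S; apply/eqmodXP => i iN.
set S := \poly_(_ < _) _.
have -> : (1 - 'X) * (1 - c *: 'X) * (1 - c' *: 'X) * (1 - (c * c') *: 'X) * S =
  S - (1 + c + c' + c * c') *: ('X^1 * S)
  + (c + c' + c * c' + c * c' + c * c * c' + c * c' * c') *: ('X^2 * S)
  - (c * c' + c * c' * c + c * c' * c' + c * c' * c * c') *: ('X^3 * S)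
  + (c * c' * c * c') *: ('X^4 * S).
  rewrite -!mul_polyC !(polyCD, polyCM, polyC1); ring.
rewrite !(coefD, coefN, coefZ, coefXnM) coef1 coefXn !coef_poly.
case: i iN => [|[|[|[|i]]]] iN; rewrite /= ?subn0 ?subSS ?subnn ?subn0.
- by rewrite iN s0 s'0; ring.
- by rewrite iN (ltnW iN) !sS !s'S s0 s'0; ring.
- rewrite iN (ltnW iN) (ltnW (ltnW iN)) !sS !s'S s0 s'0; ring.
- rewrite iN (ltnW iN) (ltnW (ltnW iN)) (ltnW (ltnW (ltnW iN))).
  rewrite !sS !s'S s0 s'0; ring.
have [i3 i2 i1 i0] : [/\ i.+3 < N, i.+2 < N, i.+1 < N & i < N]%N by split; lia.
rewrite iN i3 i2 i1 i0 !sS !s'S; ring.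
Qed.

(** With X for z^(deg P), [K] is the Euler factor of (1 - q z^2) |L|^2 / (1 - q z)^2 at a prime with
    character value c: the quotient (1 - X^2) / (1 - X)^2 leaves (1 + X) / (1 - X). *)
Lemma nneg_factor N (c : algC) : `|c| <= 1 ->
  {K : {poly algC} | nneg_coefs K &
    (1 - c *: 'X) * (1 - c^* *: 'X) * (1 - 'X) * K =[N] 1 + 'X}.
Proof.
move=> c1; pose s k := iter k (fun x => 1 + c * x) 1.
pose r := c * c^*.
(* [K = S * U] with
   [S = \sum_k |1 + c + .. + c^k|^2 X^k
      = (1 - r X^2) / ((1 - X) (1 - c X) (1 - c^* X) (1 - r X))] and
   [U = (1 + X) (1 - r X) / (1 - r X^2) = 1 + (1 - r) X / (1 - r X^2)]. *)
have r0 : 0 <= r by rewrite /r -normCK exprn_ge0.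
have r1 : 0 <= 1 - r by rewrite subr_ge0 /r -normCK expr_le1.
pose U : {poly algC} :=
  1 + (1 - r) *: 'X * \poly_(k < N) (if odd k then 0 else r ^+ k./2).
have UE : (1 - r *: 'X^2) * U =[N] (1 + 'X) * (1 - r *: 'X).
  set V : {poly algC} := \poly_(_ < _) _ in U *.
  suff VE : (1 - r *: 'X^2) * V =[N] 1.
    rewrite /eqmodX (_ : _ - _ = (1 - r) *: 'X * ((1 - r *: 'X^2) * V - 1)).
      exact: dvdp_mull.
    rewrite /U -!mul_polyC polyCB polyC1; ring.
  apply/eqmodXP => i iN.
  rewrite mulrBl mul1r -scalerAl coefB coefZ coefXnM !coef_poly coef1 iN.
  case: i iN => [|[|i]] iN //=; rewrite ?mulr0 ?subr0 ?expr0 //.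
  rewrite subSS subSS subn0 negbK (ltnW (ltnW iN)).
  by case: odd; rewrite ?mulr0 ?subr0 // exprS subrr.
exists (\poly_(k < N) (s k * (s k)^*) * U).
  apply: nneg_coefsM.
    by move=> i; rewrite coef_poly; case: ifP => // _; rewrite -normCK exprn_ge0.
  apply: (nneg_coefsD nneg_coefs1); apply: nneg_coefsM => i.
    by rewrite coefZ mulr_ge0 // coefX ler0n.
  by rewrite coef_poly; do 2![case: ifP => // _]; rewrite exprn_ge0.
have sS k : (s k.+1)^* = 1 + c^* * (s k)^* by rewrite /= rmorphD rmorphM rmorph1.
have := geom_conv_factor N (erefl : s 0%N = 1) (rmorph1 _) (fun=> erefl) sS.
rewrite -/r; set S := \poly_(_ < _) _ => SE.
apply: (@eqmodX_cancel _ _ (1 - r *: 'X)).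
  by rewrite coefB coefZ coefX coef1 mulr0 subr0 oner_neq0.
apply: eqmodX_trans (eqmodX_trans (eqmodXMr U SE) _); last first.
  by rewrite [X in _ =[_] X]mulrC.
rewrite (_ : (1 - r *: 'X) * _ =
  (1 - 'X) * (1 - c *: 'X) * (1 - c^* *: 'X) * (1 - r *: 'X) * S * U).
  exact: eqmodX_refl.
ring.
Qed.

End LocalFactor.

(** * Monic polynomials over a finite field and the Euler product *)

Section Monics.
Variable F : finFieldType.
Implicit Types (f p q P Q : {poly F}) (n N : nat).

Lemma irreducible_factor f : (1 < size f)%N ->
  exists P, [/\ irreducible_poly P, P \is monic & P %| f].
Proof.
have [n] := ubnP (size f); elim: n f => // n IH f; rewrite ltnS => fn f1.
have [irrf|] := boolP (irreducibleb f).
  have f0 : f != 0 by rewrite -size_poly_gt0 ltnW.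
  have l0 : (lead_coef f)^-1 != 0 by rewrite invr_eq0 lead_coef_eq0.
  exists ((lead_coef f)^-1 *: f); split.
  - have /irreducibleP [_ irr] := irrf.
    split=> [|q q1]; first by rewrite size_scale.
    by rewrite dvdpZr // eqp_sym (eqp_ltrans (eqp_scale _ l0)) eqp_sym; apply: irr.
  - by rewrite monicE lead_coefZ mulVf ?lead_coef_eq0.
  - by rewrite dvdpZl.
rewrite /irreducibleb f1 => /forallPn[/= q]; rewrite negb_imply -ltnNge.
rewrite -Pdiv.Idomain.dvdpE => /andP[qf q1].
have qn : (size q < n)%N.
  by apply: leq_ltn_trans (size_npoly q) _; rewrite prednK // ltnW.
have [P [irrP mP Pq]] := IH q qn q1.
by exists P; split=> //; apply: dvdp_trans qf.
Qed.

(** Written as X^n plus a lower part, so that sums over it reindex to the finite type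
    [{poly_n F}]. *)
Definition monics n : seq {poly F} := 
  [seq 'X^n + polyn p | p : {poly_n F} <- enum {poly_n F}].

Lemma uniq_monics n : uniq (monics n).
Proof. by rewrite map_inj_uniq ?enum_uniq // => p q /addrI/val_inj. Qed.

Lemma size_monics n : size (monics n) = (#|F| ^ n)%N.
Proof. by rewrite size_map -cardE card_npoly. Qed.

Lemma mem_monics n f : (f \in monics n) = (f \is monic) && (size f == n.+1).
Proof.
apply/mapP/andP => [[p _ ->]|[mf /eqP sf]].
  have sp : (size p < size ('X^n : {poly F}))%N by rewrite size_polyXn ltnS size_npoly.
  by rewrite monicE lead_coefDl // lead_coefXn size_polyDl // size_polyXn !eqxx.
have sp : (size (f - 'X^n)%R <= n)%N.
  apply/leq_sizeP => j; rewrite leq_eqVlt coefB coefXn => /predU1P[<-|nj].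
    by rewrite eqxx; move: mf; rewrite monicE /lead_coef sf => /eqP ->; rewrite subrr.
  by rewrite nth_default ?sf // gtn_eqF // subrr.
by exists (NPoly sp); rewrite ?mem_enum //= addrC subrK.
Qed.

Lemma monics0 : monics 0 = [:: 1].
Proof.
apply: perm_small_eq => //; apply: uniq_perm => // [|f]; first exact: uniq_monics.
rewrite mem_monics inE; apply/andP/eqP => [[mf /eqP sf]|->].
  by apply/eqP; rewrite -eqp_monic ?monic1 // -size_poly_eq1 sf.
by rewrite monic1 size_poly1.
Qed.

(* The bound is on [size]: the degrees are less than [N]. *)
Definition prime_polys N : seq {poly F} :=
  [seq f <- flatten [seq monics n | n <- iota 0 N] | irreducibleb f].

Lemma prime_polysP N P : reflect
  [/\ irreducible_poly P, P \is monic & (size P <= N)%N] (P \in prime_polys N).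
Proof.
rewrite mem_filter; apply: (iffP andP) => [[/irreducibleP irrP]|[irrP mP PN]].
  case/flatten_mapP=> n; rewrite mem_iota mem_monics => nN /andP[mP /eqP ->].
  by split.
split; first exact/irreducibleP.
have [P1 _] := irrP; apply/flatten_mapP; exists (size P).-1.
  by rewrite mem_iota /= add0n prednK // ltnW.
by rewrite mem_monics mP prednK ?(ltnW P1) /=.
Qed.

Lemma uniq_prime_polys N : uniq (prime_polys N).
Proof.
apply: filter_uniq; elim: N => // N IH.
rewrite -addn1 iotaD map_cat flatten_cat cat_uniq IH /= cats0 uniq_monics andbT.
apply/hasPn => f; rewrite add0n mem_monics => /andP[_ /eqP sf].
apply/flatten_mapP => -[n]; rewrite mem_iota mem_monics sf => nN /andP[_ /eqP[]].
lia.
Qed.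

Lemma irreducible_monic_eq P Q : irreducible_poly P -> irreducible_poly Q ->
  P \is monic -> Q \is monic -> P %| Q -> P = Q.
Proof.
move=> [P1 _] [_ irrQ] mP mQ PQ; apply/eqP; rewrite -eqp_monic //.
by apply: irrQ => //; rewrite gtn_eqF.
Qed.

Lemma irreducible_dvdM P p q : irreducible_poly P ->
  (P %| p * q) = (P %| p) || (P %| q).
Proof.
move=> irrP; case: (boolP (P %| p)) => [Pp|]; first by rewrite dvdp_mulr.
by rewrite -irreducible_poly_coprime // => /Gauss_dvdpr.
Qed.

Section Euler.
Variables (C : fieldType) (phi : {poly F} -> C).
Hypothesis phi1 : phi 1 = 1.
Hypothesis phiM : forall p q, phi (p * q) = phi p * phi q.

Definition Lcoef n := \sum_(f <- monics n) phi f.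

(* The Euler product is obtained by sieving out one irreducible at a time:
   excluding the multiples of [P] multiplies the series by
   [1 - phi P z^(deg P)]. *)
Let sieve ps n := \sum_(f <- monics n | all (fun p => ~~ (p %| f)) ps) phi f.

Lemma monics_dvd P n : P \is monic -> ((size P).-1 <= n)%N ->
  perm_eq [seq f <- monics n | P %| f] [seq P * f | f <- monics (n - (size P).-1)].
Proof.
move=> mP Pn; have P0 := monic_neq0 mP.
have sP : (0 < size P)%N by rewrite size_poly_gt0.
apply: uniq_perm; first exact/filter_uniq/uniq_monics.
  by rewrite map_inj_uniq ?uniq_monics //; apply: mulfI.
move=> f; rewrite mem_filter mem_monics; apply/idP/mapP => [|[e]].
  case/and3P => /dvdpP[e ->]; rewrite monicMr // => me.
  rewrite size_Mmonic ?monic_neq0 // => /eqP se.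
  exists e; last by rewrite mulrC.
  by rewrite mem_monics me; apply/eqP; lia.
rewrite mem_monics => /andP[me /eqP se] ->.
rewrite dvdp_mulr //= monicMl // me size_monicM ?monic_neq0 // se; lia.
Qed.

(** The terms removed by adding P are f = P e; as P is not in [ps], such an f survives the sieve by
    [ps] exactly when e does. *)
Lemma sieve_cons P ps n : irreducible_poly P -> P \is monic -> P \notin ps ->
  {in ps, forall Q, irreducible_poly Q /\ Q \is monic} ->
  sieve (P :: ps) n = sieve ps n -
    (if (n < (size P).-1)%N then 0 else phi P * sieve ps (n - (size P).-1)).
Proof.
move=> irrP mP Pps ips.
have -> : sieve ps n = sieve (P :: ps) n +
    \sum_(f <- monics n | (P %| f) && all (fun p => ~~ (p %| f)) ps) phi f.
  rewrite /sieve (bigID (fun f => ~~ (P %| f))) /=; congr (_ + _).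
    by apply: eq_bigl => f; rewrite andbC.
  by apply: eq_bigl => f; rewrite negbK andbC.
rewrite -addrA -[LHS]addr0; congr (_ + _); apply/esym/eqP; rewrite subr_eq0; apply/eqP.
case: ltnP => nP.
  rewrite big_seq_cond big1 // => f /and3P[]; rewrite mem_monics.
  move=> /andP[mf /eqP sf] /dvdp_leq; rewrite monic_neq0 // sf => /(_ isT).
  by rewrite leqNgt -ltn_predRL nP.
rewrite -big_filter_cond (perm_big _ (monics_dvd mP nP)) /= big_map big_distrr /=.
apply: congr_big => // f.
apply: eq_in_all => Q Qps; have [irrQ mQ] := ips Q Qps.
rewrite irreducible_dvdM //; case: (boolP (Q %| P)) => // QP.
by rewrite (irreducible_monic_eq irrQ irrP mQ mP QP) (negPf Pps) in Qps.
Qed.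

Lemma sieve_prod N ps : uniq ps ->
  {in ps, forall Q, irreducible_poly Q /\ Q \is monic} ->
  \poly_(n < N) sieve ps n =[N]
  (\prod_(P <- ps) (1 - phi P *: 'X^((size P).-1))) * \poly_(n < N) Lcoef n.
Proof.
elim: ps => [_ _|P ps IH /= /andP[Pps ups] ips].
  rewrite big_nil mul1r; apply/eqmodXP=> i iN; rewrite !coef_poly iN.
  by apply: eq_bigl.
have {}ips' : {in ps, forall Q, irreducible_poly Q /\ Q \is monic}.
  by move=> Q Qps; apply: ips; rewrite inE Qps orbT.
have [irrP mP] := ips P (mem_head _ _).
rewrite big_cons -mulrA; apply: eqmodX_trans (eqmodXMl _ (IH ups ips')).
apply/eqmodXP => i iN.
rewrite mulrBl mul1r -scalerAl coefB coefZ coefXnM !coef_poly iN sieve_cons //.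
by case: ifP => _; rewrite ?mulr0 // (leq_ltn_trans (leq_subr _ _) iN).
Qed.

(** A monic polynomial of degree between 1 and N - 1 has a prime factor of degree less than N, so
    sieving by all these primes leaves only the constant 1. *)
Lemma euler_product N :
  (\prod_(P <- prime_polys N) (1 - phi P *: 'X^((size P).-1))) *
    \poly_(n < N) Lcoef n =[N] 1.
Proof.
apply: eqmodX_trans (eqmodX_sym (sieve_prod _ (uniq_prime_polys N) _)) _.
  by move=> Q /prime_polysP[].
apply/eqmodXP => i iN; rewrite coef_poly iN coef1 /sieve.
have [->|i0] := eqVneq i 0%N.
  rewrite monics0 big_mkcond big_seq1 phi1 ifT //.
  apply/allP => Q /prime_polysP[[Q1 _] _ _].
  by rewrite dvdp1 gtn_eqF.
rewrite big_seq_cond big1 // => f /andP[]; rewrite mem_monics => /andP[mf /eqP sf].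
have [|P [irrP mP Pf]] := @irreducible_factor f; first by rewrite sf; lia.
move/allP=> noP; suff /noP : P \in prime_polys N by rewrite Pf.
apply/prime_polysP; split=> //; apply: leq_trans (dvdp_leq _ Pf) _; last by rewrite sf.
exact: monic_neq0.
Qed.

End Euler.
End Monics.

(** * Nonvanishing of L on the closed disc of radius 1/q *)

Section NonVanishing.
Variable F : finFieldType.
Local Notation q := (#|F|%:R : algC).

Lemma card_fieldC_gt1 : 1 < q.
Proof. by rewrite ltr1n card_finRing_gt1. Qed.

Lemma card_fieldC_gt0 : 0 < q.
Proof. exact: lt_trans ltr01 card_fieldC_gt1. Qed.

(** There are q^n monic polynomials of degree n, so the series for the constant function 1 is
    geometric, with inverse 1 - q X. *)
Lemma euler_product_zeta N :
  \prod_(P <- prime_polys F N) (1 - 'X^((size P).-1)) =[N] 1 - q *: 'X.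
Proof.
have := @euler_product F algC (fun=> 1) erefl (fun _ _ => esym (mulr1 1)) N.
under eq_bigr do rewrite scale1r.
set A := \prod_(_ <- _) _; set Z := \poly_(_ < _) _ => AZ.
suff Z1 : Z * (1 - q *: 'X) =[N] 1.
  rewrite -[A]mulr1; apply: eqmodX_trans (eqmodXMl _ (eqmodX_sym Z1)) _.
  by rewrite mulrA -[X in _ =[_] X]mul1r; apply: eqmodXMr.
apply/eqmodXP => i iN.
have LE n : @Lcoef F algC (fun=> 1) n = q ^+ n.
  by rewrite /Lcoef big_const_seq count_predT size_monics iter_addr_0 natrX.
rewrite mulrBr mulr1 -scalerAr coefB coefZ coefMX !coef_poly iN coef1 !LE.
case: i iN => [|i] iN /=; first by rewrite mulr0 subr0.
by rewrite (ltnW iN) exprS subrr.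
Qed.

Variables (g : {poly F}) (phi : {poly F} -> algC).
Local Notation d := (size g).-1.
Hypothesis g1 : (1 < size g)%N.
Hypothesis phi1 : phi 1 = 1.
Hypothesis phiM : forall a b, phi (a * b) = phi a * phi b.
Hypothesis phi_le1 : forall a, `|phi a| <= 1.
Hypothesis phi_mod : forall a b, g %| a - b -> phi a = phi b.
Hypothesis phi_sum : \sum_(r : {poly_d F}) phi r = 0.

(** In degree n >= d the monic polynomials are spread equally over the residues modulo g, over which
    [phi] sums to 0. *)
Lemma Lcoef_eq0 n : (d <= n)%N -> Lcoef phi n = 0.
Proof.
move=> dn; have g0 : g != 0 by rewrite -size_poly_gt0 ltnW.
(* Translation by c followed by reduction modulo g permutes the residues. *)
have sum0 (c : {poly F}) : \sum_(r : {poly_d F}) phi (c + r) = 0.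
  have sm (r : {poly_d F}) : (size ((c + r) %% g)%R <= d)%N.
    by rewrite -ltnS prednK ?(ltnW g1) // ltn_modp.
  rewrite -[RHS]phi_sum [RHS](reindex_inj (h := fun r => NPoly (sm r))) /=.
    apply: eq_bigr => r _; apply: phi_mod.
    by rewrite {1}(divp_eq (c + r) g) addrK dvdp_mulIr.
  move=> r r' /(congr1 val) /= /eqP.
  rewrite -subr_eq0 -modpN -modpD opprD addrACA subrr add0r => /eqP/modp_eq0P rr.
  apply: val_inj => /=; apply/eqP; rewrite -subr_eq0 -size_poly_eq0.
  apply: contraTT rr; rewrite size_poly_eq0 => rr0; rewrite gtNdvdp //.
  apply: leq_ltn_trans (size_polyD _ _) _.
  have szr (e : {poly_d F}) : (size e < size g)%N.
    by apply: leq_ltn_trans (size_npoly e) _; rewrite (ltn_predK g1).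
  by rewrite size_polyN gtn_max !szr.
(* Average over the translates of the summation variable by all residues. *)
have: (#|{poly_d F}|)%:R * Lcoef phi n = 0.
  rewrite mulr_natl -sumr_const.
  transitivity (\sum_(r : {poly_d F}) \sum_(p : {poly_n F}) phi ('X^n + p + r)).
    apply: eq_bigr => r _; rewrite /Lcoef big_map big_enum /=.
    rewrite (reindex_inj (addIr (npolyp n r))) /=.
    apply: eq_bigr => p _; rewrite npolypK ?addrA //.
    exact: leq_trans (size_npoly r) dn.
  by rewrite exchange_big big1 //.
move/eqP; rewrite mulf_eq0 => /orP[|/eqP//].
by rewrite card_npoly pnatr_eq0 expn_eq0 gtn_eqF // (ltnW (card_finRing_gt1 F)).
Qed.

Definition Lpoly := \poly_(n < d) Lcoef phi n.

Lemma Lpoly_coef n : Lpoly`_n = Lcoef phi n.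
Proof. by rewrite coef_poly; case: ltnP => // /Lcoef_eq0. Qed.

Lemma Lpoly0 : Lpoly`_0 = 1.
Proof. by rewrite Lpoly_coef /Lcoef monics0 big_seq1. Qed.

Lemma euler_product_Lpoly N :
  (\prod_(P <- prime_polys F N) (1 - phi P *: 'X^((size P).-1))) * Lpoly =[N] 1.
Proof.
apply: eqmodX_trans (euler_product phi1 phiM N); apply: eqmodXMl.
by apply/eqmodXP => i iN; rewrite Lpoly_coef coef_poly iN.
Qed.

Lemma Lpoly_neq0 (x : algC) : `|x| <= 1 -> Lpoly.[x / q] != 0.
Proof.
move=> x1; apply/negP => /eqP Lx0.
have q0 := card_fieldC_gt0; have qn0 : q != 0 by rewrite gt_eqF.
(* Twisting by x^(deg f) keeps multiplicativity and the bound 1, and moves the zero from x/q to 1/q.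
   The polynomial 0 is set apart because its exponent would be 0. *)
pose psi (f : {poly F}) : algC := if f == 0 then 0 else phi f * x ^+ (size f).-1.
have psi1 : psi 1 = 1 by rewrite /psi oner_eq0 size_poly1 expr0 mulr1.
have psiM (a b : {poly F}) : psi (a * b) = psi a * psi b.
  rewrite /psi mulf_eq0; have [_|a0] := eqVneq a 0; first by rewrite mul0r.
  have [_|b0] := eqVneq b 0; first by rewrite mulr0.
  rewrite /= phiM size_mul // mulrACA -exprD; congr (_ * x ^+ _).
  move: a0 b0; rewrite -!size_poly_gt0; case: (size a) => // n _.
  by case: (size b) => // m _; rewrite addSn addnS.
have psi_le1 a : `|psi a| <= 1.
  rewrite /psi; case: ifP => _; first by rewrite normr0.
  by rewrite normrM mulr_ile1 ?normrX ?exprn_ge0 ?exprn_ile1.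
have psiE n : Lcoef psi n = x ^+ n * Lcoef phi n.
  rewrite /Lcoef big_distrr /= big_seq [RHS]big_seq; apply: eq_bigr => f.
  rewrite mem_monics => /andP[mf /eqP sf].
  by rewrite /psi (negPf (monic_neq0 mf)) sf mulrC.
(* Since q is real, the conjugate series vanishes at 1/q as well. *)
pose psi' (f : {poly F}) : algC := (psi f)^*.
have psi'1 : psi' 1 = 1 by rewrite /psi' psi1 rmorph1.
have psi'M (a b : {poly F}) : psi' (a * b) = psi' a * psi' b.
  by rewrite /psi' psiM rmorphM.
have psi'E n : Lcoef psi' n = (Lcoef psi n)^* by rewrite /Lcoef rmorph_sum.
pose M : {poly algC} := \poly_(n < d) Lcoef psi n.
pose M' : {poly algC} := \poly_(n < d) Lcoef psi' n.
have Mx0 : M.[q^-1] = 0.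
  rewrite -[RHS]Lx0 !horner_poly; apply: eq_bigr => i _.
  by rewrite psiE exprMn mulrCA mulrA.
have M'x0 : M'.[q^-1] = 0.
  rewrite -[RHS](rmorph0 Num.conj) -Mx0 !horner_poly rmorph_sum.
  apply: eq_bigr => i _; rewrite psi'E rmorphM rmorphXn fmorphV.
  by rewrite rmorph_nat.
have fact (p : {poly algC}) : p.[q^-1] = 0 ->
    exists p1 : {poly algC}, p = (1 - q *: 'X) * p1.
  move/eqP/factor_theorem => [p1 ->]; exists (- q^-1 *: p1).
  rewrite -scalerAr scalerAl mulrC; congr (_ * _).
  rewrite scaleNr scalerBr scalerA mulVf // scale1r opprB; congr (_ - _).
  by rewrite -alg_polyC.
have [M1 ME] := fact _ Mx0; have [M1' M'E] := fact _ M'x0.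
have c0 : (1 - q *: 'X)`_0 != 0 :> algC.
  by rewrite coefB coefZ coefX coef1 mulr0 subr0 oner_neq0.
(* This is M M' (1 - q X^2) / (1 - q X)^2: the two zeros at 1/q cancel the double pole. *)
pose E : {poly algC} := M1 * M1' * (1 - q *: 'X^2).
have EN N : exists2 K, nneg_coefs K & E =[N] K.
  pose K (P : {poly F}) := s2val (nneg_factor N (psi_le1 P)) \Po 'X^((size P).-1).
  exists (\prod_(P <- prime_polys F N) K P).
    apply: nneg_coefs_prod => P /prime_polysP[[P1 _] _ _].
    apply: nneg_coefs_comp_Xn; last exact: (s2valP (nneg_factor _ _)).
    by rewrite ltn_predRL.
  set KK := \prod_(P <- _) K P.
  pose Z : {poly algC} := \prod_(P <- prime_polys F N) (1 - 'X^((size P).-1)).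
  pose Y : {poly algC} := \prod_(P <- prime_polys F N) (1 + 'X^((size P).-1)).
  pose A f : {poly algC} := \prod_(P <- prime_polys F N) (1 - f P *: 'X^((size P).-1)).
  have hZ : Z =[N] 1 - q *: 'X := euler_product_zeta N.
  have ZYE : Z * Y =[N] 1 - q *: 'X^2.
    (* The factors multiply to 1 - X^(2 deg P), so the product is the inverse zeta series in X^2. *)
    rewrite (_ : Z * Y = Z \Po 'X^2); last first.
      rewrite /Z /Y -big_split rmorph_prod /=; apply: eq_bigr => P _.
      by rewrite comp_polyB comp_polyC comp_Xn_poly -subr_sqr expr1n exprAC.
    apply: eqmodX_trans (eqmodX_comp _ hZ) _ => //.
    by rewrite comp_polyB comp_polyC comp_polyZ comp_polyX; apply: eqmodX_refl.
  have AME f (p : {poly algC}) : f 1 = 1 -> (forall a b, f (a * b) = f a * f b) ->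
      (forall n, p`_n = Lcoef f n) -> A f * p =[N] 1.
    move=> f1 fM pE; apply: eqmodX_trans (euler_product f1 fM N).
    by apply: eqmodXMl; apply/eqmodXP => i iN; rewrite pE coef_poly iN.
  have AM : A psi * M =[N] 1.
    apply: AME => // n; rewrite coef_poly; case: ltnP => // /Lcoef_eq0.
    by rewrite psiE => ->; rewrite mulr0.
  have AM' : A psi' * M' =[N] 1.
    apply: AME => // n; rewrite coef_poly; case: ltnP => // /Lcoef_eq0.
    by rewrite psi'E psiE => ->; rewrite mulr0 rmorph0.
  have AK : A psi * A psi' * Z * KK =[N] Y.
    rewrite /A /Z /KK -!big_split /=; apply: eqmodX_prod => P /prime_polysP[[P1 _] _ _].
    have P0 : (0 < (size P).-1)%N by rewrite ltn_predRL.
    have := eqmodX_comp P0 (s2valP' (nneg_factor N (psi_le1 P))).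
    by rewrite !(comp_polyM, comp_polyB, comp_polyD, comp_polyC, comp_polyZ,
      comp_polyX).
  (* Multiplication by (1 - q X)^2 turns [E] into M M' (1 - q X^2). There Z Y replaces 1 - q X^2,
     the Euler products cancel M and M', and Z^2 [KK] remains, which is (1 - q X)^2 [KK]. *)
  apply: (eqmodX_cancel c0); apply: (eqmodX_cancel c0).
  rewrite (_ : _ * (_ * E) = M * M' * (1 - q *: 'X^2)); last first.
    by rewrite /E ME M'E; ring.
  apply: eqmodX_trans (eqmodXMl _ (eqmodX_sym ZYE)) _.
  apply: eqmodX_trans (eqmodXMl _ (eqmodXMl _ (eqmodX_sym AK))) _.
  rewrite (_ : M * M' * (Z * (A psi * A psi' * Z * KK)) =
    (A psi * M) * (A psi' * M') * (Z * (Z * KK))); last by ring.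
  rewrite -[X in _ =[_] X]mul1r -[X in _ =[_] X * _]mul1r.
  apply: eqmodXM; first exact: eqmodXM.
  by apply: eqmodXM => //; apply: eqmodXMr.
have E_ge0 : nneg_coefs E.
  by move=> i; have [K K0 /eqmodXP ->] := EN i.+1.
have L0 (f : {poly F} -> algC) : f 1 = 1 -> Lcoef f 0 = 1.
  by rewrite /Lcoef monics0 big_seq1.
have E0 : E`_0 = 1.
  have e0 : M`_0 * M'`_0 = 1 by rewrite !coef_poly ltn_predRL g1 !L0 // mulr1.
  rewrite -[RHS]e0 ME M'E /E !coef0M !coefB !coefZ coefX coefXn coef1.
  by rewrite !mulr0 subr0 mulr1 !mul1r.
have := nneg_coefs_horner E_ge0 (_ : 0 <= (sqrtC q)^-1).
rewrite invr_ge0 sqrtC_ge0 ltW // => /(_ isT).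
rewrite E0 /E hornerM hornerD hornerN hornerZ hornerXn hornerC exprVn sqrtCK.
by rewrite mulfV // subrr mulr0 ler10.
Qed.

(** The constant term 1 excludes the root 0, and a root z with |z q| <= 1 is excluded by
    [Lpoly_neq0] at x = z q; the list consists of the inverses of the roots. *)
Lemma Lpoly_factor : exists2 l : seq algC, all (fun a => `|a| < q) l &
  Lpoly = \prod_(a <- l) (1 - a *: 'X).
Proof.
have [r rE] := closed_field_poly_normal Lpoly.
have L0 : Lpoly != 0.
  by apply: contra_eq_neq Lpoly0 => ->; rewrite coef0 eq_sym oner_neq0.
have root_r z : z \in r -> Lpoly.[z] = 0.
  move=> zr; apply/eqP; rewrite -/(root Lpoly z) rE rootZ ?lead_coef_eq0 //.
  by rewrite root_prod_XsubC.
have r0 z : z \in r -> z != 0.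
  move=> /root_r Lz; apply: contra_eq_neq Lpoly0 => z0.
  by rewrite -horner_coef0 -z0 Lz eq_sym oner_neq0.
exists [seq z^-1 | z <- r].
  rewrite all_map; apply/allP => z zr /=; have z0 := r0 z zr.
  have q0 := card_fieldC_gt0; rewrite real_ltNge ?normr_real ?realn //.
  apply/negP => qz; have /Lpoly_neq0 : `|z * q| <= 1.
    rewrite normrM normr_nat -ler_pdivlMl ?normr_gt0 // mulr1.
    by rewrite -normfV.
  by rewrite mulfK ?(gt_eqF q0) // root_r ?eqxx.
have [k kE] : exists k, Lpoly = k *: \prod_(z <- r) (1 - z^-1 *: 'X).
  rewrite rE big_seq; set k0 := lead_coef _.
  exists (k0 * \prod_(z <- r | z \in r) (- z)).
  rewrite -scalerA; congr (_ *: _); rewrite [X in _ *: X]big_seq -scaler_prod.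
  apply: eq_bigr => z zr; rewrite scalerBr scalerA mulNr mulfV ?r0 //.
  by rewrite scaleN1r opprK addrC scaleNr -alg_polyC.
rewrite big_map kE; suff -> : k = 1 by rewrite scale1r.
have := Lpoly0; rewrite kE coefZ -horner_coef0 horner_prod big1 ?mulr1 // => z _.
by rewrite hornerD hornerN hornerZ hornerX hornerC mulr0 subr0.
Qed.

End NonVanishing.

(** * The explicit formula for sums over prime powers *)

Section PowerSums.
Variable F : finFieldType.
Local Notation q := (#|F|%:R : algC).

(* The sum of [Lambda(f) phi(f)] over monic [f] of degree [n], where [Lambda] is
   the von Mangoldt function ([Lambda(P^k) = deg P]). *)
Definition psi_sum (phi : {poly F} -> algC) n :=
  \sum_(P <- prime_polys F n.+1 | ((size P).-1 %| n)%N)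
     ((size P).-1)%:R * phi P ^+ (n %/ (size P).-1).

(** Both sides are of the form [euler_prod], so their n-th power sums agree. For zeta, [l] is the
    single q; for a nontrivial character, [s] holds the reciprocal roots of L. *)
Lemma psi_sum_eq n (phi : {poly F} -> algC) (l s : seq algC) : (0 < n)%N ->
  \prod_(P <- prime_polys F n.+1) (1 - phi P *: 'X^((size P).-1)) *
    \prod_(a <- s) (1 - a *: 'X)
     =[n.+1] \prod_(a <- l) (1 - a *: 'X) ->
  psi_sum phi n = \sum_(a <- l) a ^+ n - \sum_(a <- s) a ^+ n.
Proof.
move=> n0 e.
pose lP := [seq ((size P).-1, phi P) | P : {poly F} <- prime_polys F n.+1].
pose lin := map (fun a : algC => (1%N, a)).
have P0 : all (fun x => 0 < x.1)%N (lP ++ lin s).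
  rewrite all_cat !all_map; apply/andP; split; last exact/allP.
  by apply/allP => P /prime_polysP[[P1 _] _ _] /=; rewrite ltn_predRL.
have l0 : all (fun x => 0 < x.1)%N (lin l) by rewrite all_map; apply/allP.
have := @eq_power_sum _ n.+1 n _ _ P0 l0.
rewrite /euler_prod /power_sum big_cat !big_map /= => /(_ e).
rewrite n0 ltnSn big_cat !big_map /= => /(_ isT) E.
have ES (t : seq algC) :
    \sum_(a <- t | (1 %| n)%N) 1 * a ^+ (n %/ 1) = \sum_(a <- t) a ^+ n.
  by rewrite dvd1n; apply: eq_bigr => a _; rewrite mul1r divn1.
by rewrite !ES in E; rewrite -E addrK.
Qed.

Lemma psi_sum1 n : (0 < n)%N -> psi_sum (fun=> 1) n = q ^+ n.
Proof.
move=> n0; rewrite (@psi_sum_eq n _ [:: q] [::]) ?big_seq1 ?big_nil ?subr0 //.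
rewrite mulr1; under eq_bigr do rewrite scale1r; exact: euler_product_zeta.
Qed.

End PowerSums.

(** * Sequences of smaller order than q^n *)

Lemma quadratic_le_exp2 k : exists n0, forall n, (n0 <= n)%N ->
  (k * n.+1 ^ 2 <= 2 ^ n)%N.
Proof.
exists (16 * k)%N => n kn.
(* Then 2^n >= (2^j)^4 >= (j + 1)^4; one factor (j + 1)^2 absorbs 16 k, and 16 times the other is at
   least (n + 1)^2. *)
have [j [nj jn]] : exists j, (4 * j <= n /\ n < 4 * j.+1)%N.
  by exists (n %/ 4)%N; lia.
apply: (@leq_trans (j.+1 ^ 4)); last first.
  apply: leq_trans (leq_pexp2l _ nj) => //.
  by rewrite mulnC expnM leq_exp2r // ltn_expl.
have kj : (16 * k <= j.+1 ^ 2)%N.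
  have k4 : (4 * k <= j.+1)%N by lia.
  have kk : (k <= k * k)%N by case: (k) => // m; rewrite leq_pmulr.
  by have := leq_mul k4 k4; rewrite -mulnn; lia.
apply: (@leq_trans (k * (4 * j.+1) ^ 2)%N); first by rewrite leq_mul // leq_exp2r.
by rewrite expnMn mulnA (mulnC k) (expnD _ 2 2) leq_mul.
Qed.

Section Negligible.
Variable F : finFieldType.
Local Notation q := (#|F|%:R : algC).

(** The relation e n = o(q^n), phrased with natural multiples to avoid limits. *)
Definition negligible (e : nat -> algC) :=
  forall k : nat, exists n0, forall n, (n0 <= n)%N -> k%:R * `|e n| <= q ^+ n.

Lemma negligible_le e e' n1 : (forall n, (n1 <= n)%N -> `|e n| <= `|e' n|) ->
  negligible e' -> negligible e.
Proof.
move=> ee' e'0 k; have [n0 Hn] := e'0 k; exists (maxn n0 n1) => n.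
rewrite geq_max => /andP[/Hn + /ee' ee]; apply: le_trans.
by rewrite ler_wpM2l // ler0n.
Qed.

Lemma negligible0 : negligible (fun=> 0).
Proof. by move=> k; exists 0%N => n _; rewrite normr0 mulr0 exprn_ge0 ?ler0n. Qed.

Lemma negligibleD e e' : negligible e -> negligible e' ->
  negligible (fun n => e n + e' n).
Proof.
move=> e0 e'0 k; have [n0 H0] := e0 (2 * k)%N; have [n1 H1] := e'0 (2 * k)%N.
exists (maxn n0 n1) => n; rewrite geq_max => /andP[/H0{}H0 /H1{}H1].
rewrite -(ler_pM2l (x := 2)) ?ltr0n // mulrA -natrM.
apply: le_trans (ler_wpM2l _ (ler_normD _ _)) _; first exact: ler0n.
by rewrite mulrDr [leRHS]mulr_natl mulr2n lerD.
Qed.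

Lemma negligible_sum (I : Type) (r : seq I) (P : pred I) (e : I -> nat -> algC) :
  (forall i, P i -> negligible (e i)) ->
  negligible (fun n => \sum_(i <- r | P i) e i n).
Proof.
move=> e0; elim: r => [|i r IH].
  by apply: (@negligible_le _ _ 0) negligible0 => n _; rewrite big_nil.
have [Pi|nPi] := boolP (P i); last first.
  by apply: (@negligible_le _ _ 0) IH => n _; rewrite big_cons (negPf nPi).
apply: (@negligible_le _ _ 0) (negligibleD (e0 i Pi) IH) => n _.
by rewrite big_cons Pi.
Qed.

Lemma negligibleZ c e : negligible e -> negligible (fun n => c%:R * e n).
Proof.
move=> e0 k; have [n0 H] := e0 (k * c)%N; exists n0 => n /H.
by rewrite normrM normr_nat natrM mulrA.
Qed.

Lemma negligible_square : negligible (fun n => (n.+1 ^ 2)%:R).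
Proof.
move=> k; have [n0 H] := quadratic_le_exp2 k; exists n0 => n /H kn.
rewrite normr_nat -natrM -natrX ler_nat; apply: leq_trans kn _.
by case: n => // n; rewrite leq_exp2r // card_finRing_gt1.
Qed.

(** This will bound the contribution of proper prime powers. Of q^n about half the exponent is
    spare, enough to absorb the factor k n q. *)
Lemma negligible_half : negligible (fun n => (n * #|F| ^ (n./2).+1)%:R).
Proof.
move=> k; have [n0 H] := quadratic_le_exp2 (2 * k * #|F|); exists (2 * n0).+1 => n nn.
rewrite normr_nat -natrM -natrX ler_nat.
have q0 : (0 < #|F|)%N by apply: ltnW (card_finRing_gt1 F).
have /H {}H : (n0 <= n./2)%N by lia.
apply: (@leq_trans (#|F| ^ (n./2 + n./2))); last by rewrite leq_pexp2l //; lia.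
rewrite expnD expnS !mulnA leq_mul // (leq_trans _ (leq_trans H _)) //; last first.
  by case: (n./2) => // m; rewrite leq_exp2r // card_finRing_gt1.
have nm : (n <= 2 * (n./2).+1 ^ 2)%N by rewrite -mulnn; nia.
nia.
Qed.

Lemma bernoulli_ineq (x : algC) n : 0 <= x -> 1 + n%:R * x <= (1 + x) ^+ n.
Proof.
move=> x0; elim: n => [|n IH]; first by rewrite mul0r addr0 expr0.
rewrite exprS; apply: le_trans (ler_wpM2l _ IH); last by rewrite addr_ge0.
rewrite -subr_ge0 (_ : _ - _ = n%:R * x ^+ 2); last by rewrite -natr1; ring.
by rewrite mulr_ge0 ?ler0n ?exprn_ge0.
Qed.

(** For a nonzero, (q / |a|)^n grows at least linearly by Bernoulli's inequality. *)
Lemma negligible_exp a : `|a| < q -> negligible (fun n => a ^+ n).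
Proof.
have [->|a0] := eqVneq a 0.
  move=> _ k; exists 1%N => -[|n] // _.
  by rewrite exprS mul0r normr0 mulr0 exprn_ge0 ?ler0n.
rewrite -normr_gt0 in a0 *; move=> aq k.
pose x := q / `|a| - 1.
have x0 : 0 < x by rewrite subr_gt0 ltr_pdivlMr // mul1r.
pose m := Num.Def.archi_bound (k%:R / x).
have mx : k%:R <= m%:R * x.
  rewrite -ler_pdivrMr //; apply/ltW/archi_boundP.
  by rewrite divr_ge0 ?ler0n // ltW.
exists m => n mn.
rewrite normrX -ler_pdivlMr ?exprn_gt0 // -expr_div_n.
rewrite (_ : q / `|a| = 1 + x); last by rewrite /x addrC subrK.
apply: le_trans (bernoulli_ineq n (ltW x0)).
apply: le_trans mx _; apply: le_trans (_ : n%:R * x <= _).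
  by rewrite ler_wpM2r ?ler_nat // ltW.
by rewrite lerDr ler01.
Qed.

Lemma negligible_lt_pow e : negligible e -> exists n0, forall n, (n0 <= n)%N ->
  `|e n| < q ^+ n.
Proof.
move=> /(_ 2%N)[n0 H]; exists n0 => n /H.
have : 0 < q ^+ n by rewrite exprn_gt0 // card_fieldC_gt0.
have := normr_ge0 (e n); set a := `|_|; set b := _ ^+ n => a0 b0 ab.
have [a00|an0] := eqVneq a 0; first by rewrite a00.
apply: lt_le_trans ab; rewrite mulr_natl mulr2n ltrDl lt_neqAle eq_sym an0 //.
Qed.

End Negligible.

(** * Dirichlet characters modulo a monic g *)

Section Characters.
Variables (F : finFieldType) (g : {poly F}).
Hypotheses (mg : g \is monic) (g1 : (1 < size g)%N).
Local Notation R := {poly %/ g}.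
Local Notation U := [set: {unit R}]%G.

Let mkg : mk_monic g = g.
Proof. by rewrite /mk_monic g1 mg. Qed.

Lemma in_qpolyE a : in_qpoly g a = a %% g :> {poly F}.
Proof. by rewrite /= mkg Pdiv.IdomainMonic.modpE. Qed.

Lemma in_qpoly_eq a b : (in_qpoly g a == in_qpoly g b) = (g %| a - b).
Proof.
by rewrite -val_eqE /= mkg -!Pdiv.IdomainMonic.modpE // -subr_eq0 -modpN -modpD.
Qed.

Lemma unit_in_qpoly a : (in_qpoly g a \is a GRing.unit) = coprimep g a.
Proof.
have E x : coprimep (mk_monic g) x = coprimep g x by rewrite mkg.
rewrite -[RHS]coprimep_modr -in_qpolyE; exact: E.
Qed.

(** An irreducible character of the unit group, extended by 0 to the polynomials not coprime to
    g. *)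
Definition dirichlet_char (i : Iirr U) (a : {poly F}) : algC :=
  if insub (in_qpoly g a) is Some u then 'chi_i u else 0.

Lemma abelian_units : abelian U.
Proof. by apply/centsP => u _ v _; apply: val_inj; rewrite /= mulrC. Qed.

Lemma chi_lin (i : Iirr U) : 'chi_i \is a linear_char.
Proof. exact/char_abelianP/abelian_units. Qed.

Lemma dirichlet_char1 i : dirichlet_char i 1 = 1.
Proof.
rewrite /dirichlet_char in_qpoly1 -[1](FinRing.val_unit1 R) valK.
exact/lin_char1/chi_lin.
Qed.

Lemma dirichlet_charM i a b :
  dirichlet_char i (a * b) = dirichlet_char i a * dirichlet_char i b.
Proof.
rewrite /dirichlet_char in_qpolyM; case: (insubP _ (in_qpoly g a)) => [u _ <-|nu].
  case: (insubP _ (in_qpoly g b)) => [v _ <-|nv].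
    by rewrite -FinRing.val_unitM valK lin_charM ?chi_lin ?inE.
  by rewrite insubN ?mulr0 // unitrM (negPf nv) andbF.
by rewrite insubN ?mul0r // unitrM (negPf nu).
Qed.

Lemma dirichlet_char_le1 i a : `|dirichlet_char i a| <= 1.
Proof.
rewrite /dirichlet_char; case: insub => [u|]; last by rewrite normr0 ler01.
by rewrite normC_lin_char ?chi_lin ?inE.
Qed.

Lemma dirichlet_char_mod i a b : g %| a - b -> dirichlet_char i a = dirichlet_char i b.
Proof. by rewrite -in_qpoly_eq /dirichlet_char => /eqP ->. Qed.

Lemma dirichlet_char0 a : dirichlet_char 0 a = (coprimep g a)%:R.
Proof.
rewrite /dirichlet_char -unit_in_qpoly; case: insubP => [u -> _|/negPf -> //].
by rewrite irr0 cfun1E inE.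
Qed.

(** Nonunits contribute 0, and over the units this is orthogonality to the trivial character. *)
Lemma dirichlet_char_sum i : i != 0 ->
  \sum_(r : {poly_((size g).-1) F}) dirichlet_char i r = 0.
Proof.
move=> i0.
pose d := (size g).-1.
have inq (r : {poly F}) : (size r <= d)%N -> in_qpoly g r = r :> {poly F}.
  by move=> rd; apply: in_qpoly_small; rewrite mkg -(ltn_predK g1).
have szR (x : R) : (size x <= d)%N.
  have E n : (n < size (mk_monic g))%N = (n < size g)%N by rewrite mkg.
  by rewrite -ltnS (ltn_predK g1) -E size_mk_monic.
rewrite (reindex (fun x : R => npolyp d x)) /=; last first.
  exists (fun r : {poly_d F} => in_qpoly g r) => [x _|r _].
    by apply: val_inj; rewrite (npolypK (szR x)); apply: inq.
  apply: val_inj; exact: etrans (npolypK (szR _)) (inq _ (size_npoly r)).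
transitivity (\sum_(x : R) if insub x is Some u then 'chi[U]_i u else 0).
  apply: eq_bigr => x _; rewrite /dirichlet_char npolypK //.
  congr (if insub _ is Some u then _ else _).
  by apply: val_inj; apply: inq.
rewrite (bigID (fun x => x \is a GRing.unit)) /= [X in _ + X]big1 ?addr0; last first.
  by move=> x nx; rewrite insubN.
transitivity (\sum_(u : {unit R}) 'chi[U]_i u).
  rewrite (reindex_omap (fun u : {unit R} => val u) insub) /=; last first.
    by move=> x ux; rewrite insubT.
  by apply: eq_big => [u|u _]; rewrite valK ?eqxx ?(valP u).
have := cfdot_irr i 0; rewrite (negPf i0) irr0 cfdotE => /eqP.
rewrite mulf_eq0 invr_eq0 pnatr_eq0 (gtn_eqF (cardG_gt0 U)) /= => /eqP e.
rewrite -[RHS]e; apply: eq_big => [u|u _]; rewrite ?inE //.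
by rewrite cfun1E inE rmorph1 mulr1.
Qed.

(** Second orthogonality relation: in an abelian group classes are singletons and centralizers are
    everything. *)
Lemma dirichlet_char_orth a h : coprimep g h ->
  \sum_i dirichlet_char i a * (dirichlet_char i h)^* = (#|U| * (g %| a - h)%R)%:R.
Proof.
rewrite -unit_in_qpoly -in_qpoly_eq /dirichlet_char => uh.
case: (insubP _ (in_qpoly g h)) => [v _ vE|]; last by rewrite uh.
case: (insubP _ (in_qpoly g a)) => [u ua uE|/negPf nu].
  rewrite second_orthogonality_relation ?inE // -uE.
  rewrite (abelian_classP _ abelian_units _ (in_setT _)) inE -val_eqE /=.
  rewrite -mulr_natr -natrM -vE (_ : 'C_U[u]%g = U) //; apply/setIidPl.
  by rewrite sub_cent1 (subsetP abelian_units) ?inE.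
rewrite big1 => [|i _]; last by rewrite mul0r.
case: eqP => [e|]; last by rewrite muln0.
by rewrite e uh in nu.
Qed.

End Characters.

(** * Primes in arithmetic progressions *)

Section Dirichlet.
Variable F : finFieldType.
Local Notation q := (#|F|%:R : algC).

Lemma size_prime_polys n : (size (prime_polys F n) <= #|F| ^ n)%N.
Proof.
rewrite size_filter; apply: leq_trans (count_size _ _) _.
elim: n => // n IH.
rewrite -addn1 iotaD map_cat flatten_cat size_cat /= cats0 size_monics add0n.
rewrite addn1 expnS; apply: leq_trans (leq_mul (card_finRing_gt1 F) (leqnn _)).
by rewrite mul2n -addnn leq_add2r.
Qed.

(** A proper divisor of n is at most n/2, which bounds the number of these primes by q^(n/2 + 1),
    each of degree at most n. *)
Lemma sum_deg_proper n : (0 < n)%N ->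
  (\sum_(P <- prime_polys F n.+1 | ((size P).-1 %| n) && ((size P).-1 != n))
     (size P).-1 <= n * #|F| ^ (n./2).+1)%N.
Proof.
move=> n0; rewrite -big_filter; set s := filter _ _.
have sP P : P \in s -> [/\ P \in prime_polys F (n./2).+1 & ((size P).-1 <= n)%N].
  rewrite mem_filter => /andP[/andP[dP Pn] /prime_polysP[irrP mP _]].
  split; last exact: dvdn_leq.
  apply/prime_polysP; split=> //; case/dvdnP: dP => k.
  move: (size P) Pn => [|m] //= mn kE.
  have k2 : (1 < k)%N by case: k kE => [|[|k]] //; lia.
  by have := leq_mul k2 (leqnn m); lia.
apply: (@leq_trans (\sum_(P <- s) n)%N).
  by rewrite big_seq [leqRHS]big_seq leq_sum // => P /sP[].
rewrite big_const_seq count_predT iter_addn_0 leq_mul2l.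
apply/orP; right; apply: leq_trans (size_prime_polys _).
by apply: uniq_leq_size => [|P /sP[]//]; exact/filter_uniq/uniq_prime_polys.
Qed.

Section MonicModulus.
Variables g h : {poly F}.
Hypotheses (mg : g \is monic) (g1 : (1 < size g)%N) (gh : coprimep g h).
Local Notation U := [set: {unit {poly %/ g}}]%G.

(** By the explicit formula the sum is minus the n-th power sum of the reciprocal roots of L, all of
    modulus less than q. *)
Lemma negligible_psi_sum (i : Iirr U) : i != 0 ->
  negligible F (psi_sum (dirichlet_char i)).
Proof.
move=> i0.
have [l /allP lq lE] := Lpoly_factor g1 (dirichlet_char1 i) (dirichlet_charM i)
  (dirichlet_char_le1 i) (dirichlet_char_mod mg g1 i) (dirichlet_char_sum mg g1 i0).
have : negligible F (fun n => \sum_(a <- l | a \in l) a ^+ n).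
  by apply: negligible_sum => a /lq; apply: negligible_exp.
apply: (@negligible_le _ _ _ 1) => n n0.
rewrite (@psi_sum_eq _ n _ [::] l) // ?big_nil ?sub0r ?normrN -?big_seq //.
rewrite -lE; apply: euler_product_Lpoly => //.
- exact: dirichlet_char1.
- exact: dirichlet_charM.
- exact: dirichlet_char_mod.
- exact: dirichlet_char_sum.
Qed.

(** The principal character differs from 1 only at primes dividing g; for n >= [size g] these have
    degree less than n, so [sum_deg_proper] bounds the difference. *)
Lemma negligible_psi_sum0 :
  negligible F (fun n => psi_sum (dirichlet_char (0 : Iirr U)) n - q ^+ n).
Proof.
apply: (@negligible_le _ _ _ (size g)) (negligible_half F) => n gn.
have n0 : (0 < n)%N by apply: leq_trans gn; apply: ltnW.
rewrite -psi_sum1 // /psi_sum -sumrB.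
apply: le_trans (ler_norm_sum _ _ _) _.
have := sum_deg_proper n0; set S := (\sum_(P <- _ | _) _)%N; rewrite normr_nat => Sn.
apply: (@le_trans _ _ S%:R); last by rewrite ler_nat.
rewrite /S natr_sum big_mkcondr /= big_seq_cond [leRHS]big_seq_cond.
apply: ler_sum => P /andP[/prime_polysP[irrP mP _] Pn].
rewrite expr1n mulr1 dirichlet_char0 //.
have [_|ncop] := boolP (coprimep g P).
  by rewrite expr1n mulr1 subrr normr0; case: ifP; rewrite ?ler0n.
have Pg : P %| g by rewrite coprimep_sym irreducible_poly_coprime // negbK in ncop.
have sPg : (size P <= size g)%N by rewrite dvdp_leq // monic_neq0.
have [P1 _] := irrP.
have P0 : (0 < (size P).-1)%N by rewrite ltn_predRL.
rewrite expr0n gtn_eqF ?divn_gt0 //; last by rewrite dvdn_leq.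
rewrite mulr0 sub0r normrN normr_nat ifT // ltn_eqF //.
by apply: leq_trans gn; rewrite prednK // ltnW.
Qed.

(** After exchanging the sums, orthogonality keeps exactly the prime powers of degree n congruent to
    h. *)
Lemma char_sum_primes n :
  \sum_(i : Iirr U) (dirichlet_char i h)^* * psi_sum (dirichlet_char i) n =
  (#|U| * \sum_(P <- prime_polys F n.+1 |
     ((size P).-1 %| n)%N && (g %| P ^+ (n %/ (size P).-1) - h)) (size P).-1)%:R.
Proof.
rewrite natrM natr_sum big_mkcondr /=.
rewrite (eq_bigr _ (fun i _ => big_distrr _ _ _)) exchange_big /= mulr_sumr.
apply: eq_bigr => P _.
have chX i k : dirichlet_char i P ^+ k = dirichlet_char i (P ^+ k).
  elim: k => [|k IH]; first by rewrite !expr0 dirichlet_char1.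
  by rewrite !exprS IH dirichlet_charM.
under eq_bigr do rewrite mulrCA chX [_ * dirichlet_char _ _]mulrC.
rewrite -mulr_sumr dirichlet_char_orth // natrM.
by case: (g %| _); rewrite ?mulr1 ?mulr0 // mulrC.
Qed.

(** With fewer than B n such primes, q^n would be at most [e' n]: a quadratic term for these primes,
    one for proper prime powers, and the error [e] of the character sum. But [e'] is negligible. *)
Lemma dirichlet_monic B : exists n0, forall n, (n0 <= n)%N ->
  (B * n <= count (fun P : {poly F} => (size P == n.+1) && (g %| P - h)%R)
    (prime_polys F n.+1))%N.
Proof.
pose e n :=
  \sum_(i : Iirr U) (dirichlet_char i h)^* * psi_sum (dirichlet_char i) n - q ^+ n.
have e0 : negligible F e.
  have e0' : negligible F (fun n => (psi_sum (dirichlet_char (0 : Iirr U)) n - q ^+ n) +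
     \sum_(i : Iirr U | i != 0) (dirichlet_char i h)^* * psi_sum (dirichlet_char i) n).
    apply: negligibleD; first exact: negligible_psi_sum0.
    apply: negligible_sum => i /negligible_psi_sum.
    apply: (@negligible_le _ _ _ 0) => n _.
    by rewrite normrM norm_conjC ler_piMl ?normr_ge0 ?dirichlet_char_le1.
  apply: (@negligible_le _ _ _ 0) e0' => n _; rewrite /e (bigD1 0) //= addrAC.
  by rewrite dirichlet_char0 // gh rmorph1 mul1r.
pose e' n := (#|U| * B)%:R * (n.+1 ^ 2)%:R +
  #|U|%:R * (n * #|F| ^ (n./2).+1)%:R + `|e n|.
have [|n0 H] := @negligible_lt_pow F e'.
  apply: negligibleD; last first.
    by apply: (@negligible_le _ _ _ 0) e0 => n _; rewrite normr_id.
  apply: negligibleD; apply: negligibleZ; first exact: negligible_square.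
  exact: negligible_half.
exists n0.+1 => n nn0; have n0' : (0 < n)%N by lia.
have {H} := H n (ltnW nn0); set c := count _ _; rewrite leqNgt => eq; apply/negP => cB.
have e'0 : 0 <= e' n by rewrite !addr_ge0 // mulr_ge0 ?ler0n.
suff : q ^+ n <= e' n by rewrite -(ger0_norm e'0) lt_geF.
have -> : q ^+ n =
    (\sum_(i : Iirr U) (dirichlet_char i h)^* * psi_sum (dirichlet_char i) n) - e n.
  by rewrite /e opprB addrC subrK.
rewrite char_sum_primes; set T := (\sum_(P <- _ | _) _)%N.
have TE : (T <= n * c + n * #|F| ^ (n./2).+1)%N.
  rewrite /T (bigID (fun P : {poly F} => (size P).-1 == n)) /= leq_add //; last first.
    apply: leq_trans (sum_deg_proper n0'); rewrite big_mkcond [leqRHS]big_mkcond.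
    by apply: leq_sum => P _; case: (_ %| _)%N; case: (g %| _); case: (_ == _).
  rewrite /c -size_filter -sum1_size big_distrr /= big_filter.
  rewrite big_seq_cond [leqRHS]big_seq_cond big_mkcond [leqRHS]big_mkcond.
  apply: leq_sum => P _; case: andP => // -[Pin].
  case/andP=> /andP[_ gP] /eqP Pn; rewrite Pn divnn n0' expr1 in gP.
  have /prime_polysP[[P1 _] _ _] := Pin.
  have -> : size P = n.+1 by rewrite -Pn (ltn_predK P1).
  by rewrite Pin gP eqxx muln1.
apply: lerD; last first.
  (* The character sum is a natural number, so [e n] is real and comparable with its modulus. *)
  rewrite -normrN; apply: real_ler_norm.
  by rewrite rpredN /e char_sum_primes rpredB ?rpredX ?realn.
rewrite -!natrM -natrD ler_nat; apply: leq_trans (leq_mul (leqnn #|U|) TE) _.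
rewrite mulnDr leq_add2r -mulnA leq_mul2l.
apply/orP; right; rewrite -mulnn; nia.
Qed.
End MonicModulus.
End Dirichlet.

(** * Prime supply for any modulus, Frobenius divisibility, square-freeness *)

Section Carmichael.
Variable F : finFieldType.
Implicit Types (P Q u g h f : {poly F}).

Lemma primes_in_progression g h B : g != 0 -> coprimep g h ->
  exists n0, forall n, (n0 <= n)%N -> exists2 ps : seq {poly F},
    uniq ps && (B * n <= size ps)%N &
    {in ps, forall P, [/\ irreducible_poly P, P \is monic, size P = n.+1 & g %| P - h]}.
Proof.
move=> g0 gh.
have [g' [h' [mg' g1' gh' H]]] : exists g' h', [/\ g' \is monic, (1 < size g')%N,
    coprimep g' h' & forall P, g' %| P - h' -> g %| P - h].
  have [g1|g1] := eqVneq (size g) 1%N.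
    (* A constant g imposes no condition on P, so any nonconstant modulus serves. *)
    exists 'X, 1; rewrite monicX size_polyX coprimep1; split=> // P _.
    by move/eqP: g1; rewrite size_poly_eq1 => /eqp_dvdl ->; rewrite dvd1p.
  have l0 : (lead_coef g)^-1 != 0 by rewrite invr_eq0 lead_coef_eq0.
  exists ((lead_coef g)^-1 *: g), h; split.
  - by rewrite monicE lead_coefZ mulVf ?lead_coef_eq0.
  - by rewrite size_scale // ltn_neqAle eq_sym g1 size_poly_gt0.
  - by rewrite coprimepZl.
  - by move=> P; rewrite dvdpZl.
have [n0 Hn] := dirichlet_monic mg' g1' gh' B; exists n0 => n /Hn {}Hn.
exists [seq P : {poly F} <- prime_polys F n.+1 | (size P == n.+1) && (g' %| P - h')].
  by rewrite filter_uniq ?uniq_prime_polys ?size_filter.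
by move=> P; rewrite mem_filter => /andP[/andP[/eqP sP /H gP] /prime_polysP[]].
Qed.

(** The quotient by P is a field with q^(deg P) elements; its Fermat identity is iterated n / deg P
    times. *)
Lemma irreducible_dvd_frobenius P a n : irreducible_poly P -> P \is monic ->
  ((size P).-1 %| n)%N -> P %| a ^+ (#|F| ^ n) - a.
Proof.
move=> irrP mP /dvdnP[k ->]; have [P1 _] := irrP.
rewrite -in_qpoly_eq // rmorphXn /=; apply/eqP.
pose mi : monic_irreducible_poly P := (irrP, mP).
move: (in_qpoly P a) => x.
have xE : x ^+ (#|F| ^ (size P).-1) = x.
  have := @expf_card {poly %/ P with mi} x; rewrite card_qfpoly; exact.
by elim: k => [|k IH]; rewrite ?expn0 ?expr1 // mulSn expnD exprM xE.
Qed.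

(** A prime factor of f / gcd(f, G) would also divide the gcd, so its square would divide f. *)
Lemma squarefree_dvd f G : squarefree_poly f ->
  (forall P, irreducible_poly P -> P \is monic -> P %| f -> P %| G) -> f %| G.
Proof.
move=> sf fG; set d := gcdp f G.
have /dvdpP[e fE] : d %| f by rewrite dvdp_gcdl.
have f0 : f != 0.
  by apply/eqP => f0; have := sf 'X; rewrite size_polyX f0 dvdp0 => /(_ isT).
have e0 : e != 0 by apply: contraNneq f0 => e0; rewrite fE e0 mul0r.
suff e1 : (size e <= 1)%N.
  have -> : f %| G = (d %| G); last by rewrite dvdp_gcdr.
  apply: eqp_dvdl; rewrite {1}fE.
  have /(eqp_mulr d) : e %= 1 by rewrite -size_poly_eq1 eqn_leq e1 size_poly_gt0.
  by rewrite mul1r.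
rewrite leqNgt; apply/negP => /irreducible_factor[P [irrP mP Pe]].
have Pf : P %| f by rewrite fE dvdp_mulr.
have Pd : P %| d by rewrite dvdp_gcd Pf fG.
by have [/sf/negP[]] := irrP; rewrite fE dvdp_mul.
Qed.

Lemma squarefree_irreducible P : irreducible_poly P -> squarefree_poly P.
Proof.
move=> irrP d d1; apply/negP => ddP.
have dP : d %| P by apply: dvdp_trans ddP; rewrite dvdp_mulr.
have /eqp_size sd : d %= P by apply: irrP; rewrite // gtn_eqF.
have /dvdp_leq := ddP; rewrite irredp_neq0 // => /(_ isT).
have d0 : d != 0 by rewrite -size_poly_gt0 ltnW.
by rewrite size_mul // -sd; case: (size d) d1 => [|[|n]] // _; lia.
Qed.

Lemma squarefreeM f g : squarefree_poly f -> squarefree_poly g -> coprimep f g ->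
  squarefree_poly (f * g).
Proof.
move=> sf sg fg d d1; apply/negP => ddfg.
have [P [irrP mP Pd]] := irreducible_factor d1.
have PPfg : P * P %| f * g by apply: dvdp_trans ddfg; apply: dvdp_mul.
have [P1 _] := irrP.
have Pnu : P %| f -> P %| g -> False.
  move=> Pf Pg; have : P %| gcdp f g by rewrite dvdp_gcd Pf.
  by rewrite (eqp_dvdr _ (_ : gcdp f g %= 1)) ?dvdp1 ?gtn_eqF // -size_poly_eq1.
have: (P %| f) || (P %| g).
  by rewrite -irreducible_dvdM //; apply: dvdp_trans PPfg; apply: dvdp_mulr.
case/orP => [Pf|Pg].
  case/negP: (sf P P1); move: PPfg; rewrite Gauss_dvdpl // coprimepMl.
  by rewrite irreducible_poly_coprime //; case: (boolP (P %| g)) => // /(Pnu Pf).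
case/negP: (sg P P1); move: PPfg; rewrite Gauss_dvdpr // coprimepMl.
by rewrite irreducible_poly_coprime //; case: (boolP (P %| f)) => // /Pnu/(_ Pg).
Qed.

Lemma irreducible_dvd_prod P (ps : seq {poly F}) : irreducible_poly P -> P \is monic ->
  {in ps, forall Q, irreducible_poly Q /\ Q \is monic} ->
  (P %| \prod_(Q <- ps) Q) = (P \in ps).
Proof.
move=> irrP mP; elim: ps => [_|Q ps IH ips].
  by rewrite big_nil dvdp1; have [P1 _] := irrP; rewrite gtn_eqF.
have [irrQ mQ] := ips Q (mem_head _ _).
rewrite big_cons irreducible_dvdM // inE IH; last first.
  by move=> R Rps; apply: ips; rewrite inE Rps orbT.
by congr (_ || _); apply/idP/eqP => [/irreducible_monic_eq -> //|->].
Qed.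

Lemma squarefree_prod (ps : seq {poly F}) : uniq ps ->
  {in ps, forall Q, irreducible_poly Q /\ Q \is monic} ->
  squarefree_poly (\prod_(Q <- ps) Q).
Proof.
elim: ps => [_ _|Q ps IH /= /andP[Qps ups] ips].
  rewrite big_nil => d d1; apply/negP => /(dvdp_trans (dvdp_mulr d (dvdpp d))).
  by rewrite dvdp1 gtn_eqF.
have [irrQ mQ] := ips Q (mem_head _ _).
have ips' : {in ps, forall Q, irreducible_poly Q /\ Q \is monic}.
  by move=> R Rps; apply: ips; rewrite inE Rps orbT.
rewrite big_cons; apply: squarefreeM; first exact: squarefree_irreducible.
  exact: IH.
by rewrite irreducible_poly_coprime // irreducible_dvd_prod.
Qed.

End Carmichael.

(** * The degree of w and the construction *)

Lemma size_prod_eq (F : finFieldType) (ps : seq {poly F}) n :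
  {in ps, forall P, P \is monic /\ size P = n.+1} ->
  size (\prod_(P <- ps) P) = (size ps * n).+1.
Proof.
elim: ps => [_|P ps IH ips]; first by rewrite big_nil size_poly1.
have [mP sP] := ips P (mem_head _ _).
have ips' : {in ps, forall P, P \is monic /\ size P = n.+1}.
  by move=> R Rps; apply: ips; rewrite inE Rps orbT.
have mps : \prod_(Q <- ps) Q \is monic.
  by rewrite big_seq; apply: monic_prod => Q /ips'[].
by rewrite big_cons size_monicM ?monic_neq0 // sP IH // addnS addSn.
Qed.

Theorem theorem4p2 (F : finFieldType) (u g h : {poly F}) :
  u != 0 -> squarefree_poly u -> g != 0 -> coprimep g h ->
  forall s : seq {poly F}, exists w : {poly F},
    [/\ w \notin s, w \is monic, squarefree_poly w,
        (forall P : {poly F}, irreducible_poly P -> P \is monic -> P %| w ->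
           g %| P - h)
      & carmichael_poly (u * w)].
Proof.
move=> u0 sfu g0 gh s.
pose m := (size u).-1; pose k := m`!.
have k0 : (0 < k)%N by rewrite fact_gt0.
(* This multiple lets [p1] supply m primes and [p2] supply a k - m. *)
have [n0 H] := primes_in_progression (k + m + 1) g0 gh.
(* Beyond [n0]; larger than deg u, so that no chosen prime divides u; and at least the size of every
   member of [s], so that w is new. *)
pose a := (n0 + m + 2 + \sum_(f <- s) size f)%N.
have [p1 /andP[up1 sp1] Hp1] := H a ltac:(rewrite /a; lia).
have [p2 /andP[up2 sp2] Hp2] := H a.+1 ltac:(rewrite /a; lia).
have am : (m + 2 <= a)%N by rewrite /a; lia.
pose q1 := take m p1; pose q2 := take (a * k - m) p2.
have Hq1 : {in q1, forall P,
    [/\ irreducible_poly P, P \is monic, size P = a.+1 & g %| P - h]}.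
  by move=> P /mem_take/Hp1.
have Hq2 : {in q2, forall P,
    [/\ irreducible_poly P, P \is monic, size P = a.+2 & g %| P - h]}.
  by move=> P /mem_take/Hp2.
have sq1 : size q1 = m by rewrite size_takel //; nia.
have sq2 : size q2 = (a * k - m)%N by rewrite size_takel //; nia.
pose W := q1 ++ q2.
have irrW : {in W, forall P, irreducible_poly P /\ P \is monic}.
  by move=> P; rewrite mem_cat => /orP[/Hq1[]|/Hq2[]].
have uW : uniq W.
  rewrite cat_uniq !take_uniq // andbT /=; apply/hasPn => P /Hq2[_ _ sP _].
  by apply/negP => /Hq1[_ _]; rewrite sP => /eqP; rewrite eqn_leq ltnn.
have Wg P : P \in W -> g %| P - h by rewrite mem_cat => /orP[/Hq1[]|/Hq2[]].
have szW P : P \in W -> (a < size P)%N.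
  by rewrite mem_cat => /orP[/Hq1[_ _ ->]|/Hq2[_ _ ->]].
pose w := \prod_(P <- W) P.
have mw : w \is monic by rewrite /w big_seq; apply: monic_prod => P /irrW[].
have sqm n (ps : seq {poly F}) :
    {in ps, forall P, [/\ irreducible_poly P, P \is monic, size P = n.+1
      & g %| P - h]} ->
    \prod_(P <- ps) P \is monic /\ size (\prod_(P <- ps) P) = (size ps * n).+1.
  move=> Hps; split; first by rewrite big_seq; apply: monic_prod => P /Hps[].
  by apply: size_prod_eq => P /Hps[].
have sw : size w = (m * a + (a * k - m) * a.+1).+1.
  have [m1 s1] := sqm _ _ Hq1; have [m2 s2] := sqm _ _ Hq2.
  by rewrite /w big_cat size_monicM ?monic_neq0 // s1 s2 sq1 sq2 addSn addnS.
have su : size u = m.+1 by rewrite prednK // size_poly_gt0.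
have mak : (m < a * k)%N by nia.
(* The degree is m + m a + (a k - m)(a + 1), where m + m a = m (a + 1) cancels. *)
have suw : size (u * w)%R = (a * a.+1 * k).+1.
  rewrite size_mul ?(monic_neq0 mw) // su sw addSn addnS /=; congr S.
  by rewrite mulnBl addnBA ?leq_mul2r ?(ltnW mak) ?orbT //; lia.
have cuw : coprimep u w.
  rewrite /w big_seq; apply: (big_ind (coprimep u)) => [|x y ux uy|P PW].
  - exact: coprimep1.
  - by rewrite coprimepMr ux.
  have [irrP mP] := irrW P PW.
  rewrite coprimep_sym irreducible_poly_coprime //; apply/negP => /dvdp_leq.
  by rewrite u0 su => /(_ isT) /(leq_trans (szW P PW)); lia.
have sfw : squarefree_poly w by apply: squarefree_prod.
have sfuw : squarefree_poly (u * w) by apply: squarefreeM.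
have uw0 : u * w != 0 by rewrite mulf_neq0 ?(monic_neq0 mw).
exists w; split=> //.
- apply/negP => ws; have : (size w <= \sum_(f <- s) size f)%N.
    by rewrite (big_rem w) //= leq_addr.
  have aw : (a < size w)%N by rewrite sw; nia.
  by move/(leq_trans aw); rewrite /a; lia.
- by move=> P irrP mP; rewrite irreducible_dvd_prod // => /Wg.
split=> //; split.
  (* The quotient is not a field: an inverse of a prime factor Q modulo u w would make Q divide
     1. *)
  have [Q Qq2] : exists Q, Q \in q2.
    by case: (q2) sq2 => [/=|Q ? _]; [lia | exists Q; apply: mem_head].
  have [[Q1 _] mQ sQ _] := Hq2 Q Qq2.
  case=> _ /(_ Q) [|b uwb].
    apply/negP => /dvdp_leq; rewrite monic_neq0 // suw sQ => /(_ isT).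
    by nia.
  have Qw : Q %| u * w.
    by apply: dvdp_mull; rewrite /w (big_rem Q) ?mem_cat ?Qq2 ?orbT //= dvdp_mulr.
  have := dvdp_sub (dvdp_mulr b (dvdpp Q)) (dvdp_trans Qw uwb).
  by rewrite opprB addrC subrK dvdp1 gtn_eqF.
(* By square-freeness the congruence is checked modulo each prime factor, where deg P dividing a (a
   + 1) k suffices. *)
move=> b; apply: squarefree_dvd => // P irrP mP.
rewrite suw => Puw; apply: irreducible_dvd_frobenius => //=.
have [P1 _] := irrP.
move: Puw; rewrite irreducible_dvdM // irreducible_dvd_prod // => /orP[Pu|].
  (* A prime factor of u has degree between 1 and m, which divides k = m!. *)
  apply: dvdn_mull; apply: dvdn_fact; rewrite ltn_predRL P1 /=.
  by rewrite -ltnS (ltn_predK P1) -su dvdp_leq.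
rewrite mem_cat => /orP[/Hq1[_ _ -> _]|/Hq2[_ _ -> _]].
  by rewrite -mulnA dvdn_mulr.
by rewrite mulnAC dvdn_mull.
Qed.
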